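(* Let $c > 0$ be a constant. There exists a constant $K = K(c) > 0$ such that for every $n$ and every cross-intersecting pair of families $\mathcal{A}, \mathcal{B} \subset S_n$ with $\sqrt{|\mathcal{A}||\mathcal{B}|} \geq c(n-1)!$, there exist $i, j \in [n]$ such that \[|\{\sigma \in \mathcal{A} : \sigma(i) \neq j\}| \leq K(n-2)! \quad\text{and}\quad |\{\sigma \in \mathcal{B} : \sigma(i) \neq j\}| \leq K(n-2)!,\] i.e. all but at most $O((n-2)!)$ permutations in $\mathcal{A}$ and all but at most $O((n-2)!)$ permutations in $\mathcal{B}$ map $i$ to $j$.
   Context: $S_n$ is the symmetric group on $[n]=\{1,\ldots,n\}$. A pair of families $\mathcal{A},\mathcal{B} \subset S_n$ is cross-intersecting if for every $\sigma \in \mathcal{A}$ and every $\tau \in \mathcal{B}$ there is some $i \in [n]$ with $\sigma(i) = \tau(i)$. The $O(\cdot)$ is as $n\to\infty$ with $c$ fixed. *)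

(* Defs.v *)
From mathcomp Require Import all_boot all_order all_algebra all_fingroup.
Set Implicit Arguments. Unset Strict Implicit. Unset Printing Implicit Defensive.

Definition cross_intersecting (n : nat) (A B : {set {perm 'I_n}}) : Prop :=
  forall sigma tau, sigma \in A -> tau \in B -> exists i : 'I_n, sigma i = tau i.

(* Main.v *)
Require Import Defs.
From mathcomp Require Import all_boot all_order all_algebra all_fingroup.
From mathcomp Require Import zify.
Import Order.TTheory GRing.Theory Num.Theory.
Set Implicit Arguments.
Unset Strict Implicit.
Unset Printing Implicit Defensive.

(** A permutation is identified with its graph, an n-element subset of the grid.
A family of sets is r-spread when fixing t points divides its size by at least
r^t. Two spread families with r of order sqrt n contain disjoint members: color
the grid at random with two pairs of colors, one pair per family; counting
minimal uncovered fragments (as in the proofs of the sunflower and Kahn-Kalai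
theorems) shows that, with one color per round, two rounds suffice to contain a
member of each family in its own pair of colors.

If A is not too small, the X maximizing r^|X| |A(X)| has at most four points and
its link in A is spread. Hence all but r^3 (n-3)! members of B meet X, for
otherwise the same construction inside the rest of B would yield a disjoint
pair. This gives |A|, |B| = O((n-1)!), and a point (i, j) whose slice in B has
size of order (n-1)!. The slice of A at (i, j') with j' <> j cross-intersects
that slice away from row i, so the product bound in S_(n-1) makes it
O((n-2)!/n); summing over j', all but O((n-2)!) members of A map i to j. Then
the slice of A at (i, j) is large too, and the roles can be exchanged. *)

(** * Elementary estimates for powers, factorials and geometric sums *)

Lemma leq_card_bigcup (I J : finType) (P : pred I) (E : I -> {set J}) :
  #|\bigcup_(i | P i) E i| <= \sum_(i | P i) #|E i|.
Proof.
elim/big_rec2: _ => [|i m U _ le]; first by rewrite cards0.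
by apply: leq_trans (leq_card_setU _ _) _; rewrite leq_add2l.
Qed.

(** Each factor of [(2 * t) * ... * (t + 1)] is at least [t]; their product is ['C(2 * t, t) * t!],
    and the binomial is at most [2 ^ (2 * t)]. *)
Lemma exp_self_leq t : t ^ t <= 4 ^ t * t`!.
Proof.
have h1 : t ^ t <= (t + t) ^_ t.
  rewrite ffact_prod -[X in t ^ X](card_ord t) -prod_nat_const.
  by apply: leq_prod => i _; rewrite -addnBA ?leq_addr // ltnW.
apply: leq_trans h1 _; rewrite -bin_ffact leq_mul2r; apply/orP; right.
apply: leq_trans (_ : 2 ^ (t + t) <= _); last by rewrite addnn -mul2n expnM.
rewrite -[2]/(1 + 1) expnDn.
have lt : t < (t + t).+1 by lia.
by rewrite (bigD1 (Ordinal lt)) //= !exp1n !muln1 leq_addr.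
Qed.

Lemma bin_leq_exp n t : 'C(n, t) <= n ^ t.
Proof.
apply: leq_trans (_ : n ^_ t <= _).
  by rewrite -bin_ffact leq_pmulr ?fact_gt0.
rewrite ffact_prod -[X in n ^ X](card_ord t) -prod_nat_const.
by apply: leq_prod => i _; apply: leq_subr.
Qed.

Lemma bin_self_leq n t : 'C(n, t) * t ^ t <= (4 * n) ^ t.
Proof.
have h : 'C(n, t) * t`! <= n ^ t.
  rewrite bin_ffact ffact_prod -[X in n ^ X](card_ord t) -prod_nat_const.
  by apply: leq_prod => i _; apply: leq_subr.
rewrite expnMn; apply: leq_trans (_ : 'C(n, t) * (4 ^ t * t`!) <= _).
  by rewrite leq_mul2l exp_self_leq orbT.
by rewrite mulnCA leq_mul2l h orbT.
Qed.

(** While [r <= n - s], every factor removed from [n!] is at least [r]. Beyond that point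
    [(n - s)! <= r ^ (n - s)], which leaves [r ^ n <= n!], a consequence of
    [n ^ n <= 4 ^ n * n!]. *)
Lemma exp_fact_leq r n s : s <= n -> 4 * r <= n -> r ^ s * (n - s)`! <= n`!.
Proof.
move=> sn rn; have [lt|ge] := ltnP (n - s) r.
  have h m : m <= r -> m`! <= r ^ m.
    elim: m => // m IH mr; rewrite factS expnS leq_mul // IH //; lia.
  apply: leq_trans (_ : r ^ n <= _).
    by rewrite -[X in _ <= r ^ X](subnKC sn) expnD leq_mul2l h ?orbT //; lia.
  have h4 : 0 < 4 ^ n by rewrite expn_gt0.
  rewrite -(leq_pmul2l h4) -expnMn.
  by apply: leq_trans (exp_self_leq n); rewrite leq_exp2r //; lia.
elim: s sn ge => [|s IH] sn ge; first by rewrite mul1n subn0.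
apply: leq_trans (IH _ _); [|lia|lia].
rewrite -[n - s](_ : (n - s.+1).+1 = _); last lia.
by rewrite factS expnSr -mulnA leq_mul2l leq_mul2r; apply/orP; right; apply/orP; right; lia.
Qed.

Lemma geometric_tail (a : nat -> nat) L M :
  (forall t, 0 < t -> 16 ^ t * a t <= L) -> 15 * (\sum_(t < M | 0 < t) a t) <= L.
Proof.
move=> ha; rewrite -(big_geq_mkord _ _ xpredT).
(* The added [L] records the exact finite sum [(1 - 16 ^ -M) / 15]; without it the induction does
   not close. *)
suff h : 16 ^ M * (15 * (\sum_(1 <= t < M.+1) a t)) + L <= 16 ^ M * L.
  case: M h => [|M] h; first by rewrite big_geq ?muln0.
  have h16 : 0 < 16 ^ M.+1 by rewrite expn_gt0.
  have := leq_trans (leq_addr _ _) h; rewrite leq_pmul2l // => h'.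
  by apply: leq_trans h'; rewrite [X in _ <= 15 * X]big_nat_recr //=; lia.
elim: M => [|M IH]; first by rewrite big_geq // !muln0 mul1n.
rewrite big_nat_recr //=; have := ha M.+1 isT.
move: IH; rewrite !expnS; move: (16 ^ M) (\sum_(_ <= _ < _) _) (a _) => e S b.
nia.
Qed.

(** * Colorings by pairs of bits *)

Section Recolor.

Variable V : finType.
Implicit Types (c d : bool * bool) (T : {set V}) (chi : {ffun V -> bool * bool}).

(** The first bit of a color names the family, the second the round. *)
Definition recolor c T chi : {ffun V -> bool * bool} :=
  [ffun v => if v \in T then c else chi v].

Definition color_class c chi : {set V} := [set v | chi v == c].

Lemma color_class_recolor c T chi :
  color_class c (recolor c T chi) = T :|: color_class c chi.
Proof. by apply/setP => v; rewrite !inE ffunE; case: ifP; rewrite ?eqxx. Qed.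

Lemma color_class_recolor_neq c d T chi : c != d ->
  [disjoint T & color_class d chi] ->
  color_class d (recolor c T chi) = color_class d chi.
Proof.
move=> cd dis; apply/setP => v; rewrite !inE ffunE; case: ifP => // vT.
by rewrite (negPf cd); have := disjointFr dis vT; rewrite inE => ->.
Qed.

Lemma card_recolor_fiber c T chi' :
  #|[set chi | recolor c T chi == chi']| <= 4 ^ #|T|.
Proof.
pose f v := if v \in T then pred_of_simpl (predT : simpl_pred (bool * bool))
            else pred_of_simpl (pred1 (chi' v)).
apply: leq_trans (_ : #|family f| <= _).
  apply: subset_leq_card; apply/subsetP => chi; rewrite inE => /eqP h.
  apply/familyP => v; rewrite /f; case: ifP => // vT.
  by rewrite inE -h ffunE vT.
rewrite card_family foldrE big_map big_enum /=.
rewrite (bigID (mem T)) /= [X in _ * X]big1; last first.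
  by move=> v /negPf vT; rewrite /f vT card1.
rewrite muln1 (eq_bigr (fun=> 4)); first by rewrite prod_nat_const.
by move=> v vT; rewrite /f vT; rewrite card_prod card_bool.
Qed.

End Recolor.

(** * Minimum fragments and spread families *)

Section Fragment.

Variables (V I : finType) (F : I -> {set V}) (G : {set I}) (W : {set V}).

(** This is the minimum fragment of Park and Pham: the smallest uncovered part of a member among
    those lying inside [F i]. For [i] in [G], the index [i] is itself a candidate. *)
Definition fragment (i : I) : {set V} :=
  F [arg min_(j < i | (j \in G) && (F j :\: W \subset F i)) #|F j :\: W|] :\: W.

Lemma fragmentP i : i \in G ->
  [/\ exists2 j, j \in G & fragment i = F j :\: W,
      fragment i \subset F i &
      forall j, j \in G -> F j :\: W \subset F i ->
        #|fragment i| <= #|F j :\: W|].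
Proof.
move=> iG; rewrite /fragment; case: arg_minnP.
  by rewrite iG subsetDl.
move=> j /andP[jG jF] jmin; split=> //; first by exists j.
by move=> l lG lF; apply: jmin; rewrite lG.
Qed.

Lemma fragment_disjoint i : [disjoint fragment i & W].
Proof. by rewrite /fragment disjoints_subset subDset setUCr subsetT. Qed.

End Fragment.


(* A pair [(chi, i)] with fragment [T] is recovered from the coloring [chi']
   obtained by giving [T] the color [c], from [T], and from the old colors of
   [T]; minimality of [T] confines it to a single member [F chi' j] contained
   in the color class of [chi']. *)
Lemma fragment_count (V I : finType) (c : bool * bool)
    (F : {ffun V -> bool * bool} -> I -> {set V})
    (G : {ffun V -> bool * bool} -> {set I})
    (H : I -> {set V}) (D : {set I}) (K r L t : nat) :
  (forall chi i, i \in G chi ->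
     [/\ i \in D, F chi i \subset H i & #|F chi i| <= K]) ->
  (forall chi i (T : {set V}), i \in G chi -> T \subset F chi i ->
     F (recolor c T chi) = F chi /\ G (recolor c T chi) = G chi) ->
  (forall T : {set V}, r ^ #|T| * #|[set i in D | T \subset H i]| <= L) ->
  r ^ t * #|[set p : {ffun V -> bool * bool} * I | (p.2 \in G p.1) &&
     (#|fragment (F p.1) (G p.1) (color_class c p.1) p.2| == t)]| <=
  4 ^ #|V| * ('C(K, t) * (4 ^ t * L)).
Proof.
move=> hG hinv hspread.
pose sub (chi : {ffun V -> bool * bool}) : {set {set V}} :=
  if [pick j in G chi | F chi j \subset color_class c chi] is Some j
  then [set T : {set V} | T \subset F chi j & #|T| == t] else set0.
have card_sub chi : #|sub chi| <= 'C(K, t).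
  rewrite /sub; case: pickP => [j /andP[jG _]|_]; last by rewrite cards0.
  by rewrite cards_draws leq_bin2l //; have [] := hG _ _ jG.
pose E (chi : {ffun V -> bool * bool}) (T : {set V}) :=
  setX [set chi0 | recolor c T chi0 == chi] [set i in D | T \subset H i].
set P := [set p | _].
have PE : P \subset \bigcup_chi \bigcup_(T in sub chi) E chi T.
  apply/subsetP => -[chi i]; rewrite inE /= => /andP[iG /eqP Tt].
  set T := fragment _ _ _ _ in Tt.
  have [[j jG Tj] TF Tmin] := fragmentP (F chi) (color_class c chi) iG.
  rewrite -/T in Tj TF Tmin.
  have [eF eG] := hinv _ _ _ iG TF.
  apply/bigcupP; exists (recolor c T chi) => //.
  apply/bigcupP; exists T; last first.
    rewrite !inE eqxx /=; have [-> FH _] := hG _ _ iG.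
    exact: subset_trans TF FH.
  rewrite /sub eF eG color_class_recolor; case: pickP => [l /andP[lG lW]|none].
    rewrite inE Tt eqxx andbT.
    (* The new color class is [T] together with the old one, so the uncovered part of [l] lies in
       [T], hence in [F chi i]; minimality makes it equal to [T]. *)
    have lT : F chi l :\: color_class c chi \subset T by rewrite subDset setUC.
    have := Tmin l lG (subset_trans lT TF) => le.
    have /eqP <- : F chi l :\: color_class c chi == T by rewrite eqEcard lT.
    exact: subsetDl.
  by have := none j; rewrite jG Tj /= setUC -subDset subxx.
(* For each new coloring there are at most ['C(K, t)] sets [T], each with at most [4 ^ t] old
   colorings and, by spreadness, [L / r ^ t] indices. *)
apply: leq_trans (_ : r ^ t * \sum_chi \sum_(T in sub chi) #|E chi T| <= _).
  rewrite leq_mul2l; apply/orP; right; apply: leq_trans (subset_leq_card PE) _.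
  apply: leq_trans (leq_card_bigcup _ _) _; apply: leq_sum => chi _.
  exact: leq_card_bigcup.
have cardT : 4 ^ #|V| = #|{ffun V -> bool * bool}|.
  by rewrite card_ffun card_prod card_bool.
rewrite cardT -sum_nat_const big_distrr /=.
apply: leq_sum => chi _; rewrite big_distrr /=.
apply: leq_trans (_ : \sum_(T in sub chi) 4 ^ t * L <= _); last first.
  by rewrite sum_nat_const leq_mul2r card_sub orbT.
apply: leq_sum => T; rewrite /sub; case: pickP => [j _|_]; last by rewrite inE.
rewrite inE => /andP[_ /eqP <-]; rewrite cardsX mulnCA leq_mul //.
exact: card_recolor_fiber.
Qed.

(* Two rounds of fragments, one per color [(b, _)]: the first leaves at most [k]
   uncovered points of a typical member, the second leaves none. *)
Lemma spread_covered (V I : finType) (D : {set I}) (H : I -> {set V})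
    (N r k : nat) (b : bool) :
  0 < N -> 0 < #|D| -> (forall i, i \in D -> #|H i| <= N) ->
  (forall T : {set V},
     r ^ #|T| * #|[set i in D | T \subset H i]| <= 2 * #|D|) ->
  64 * k <= r -> 256 * N <= k * r ->
  15 * #|[set chi : {ffun V -> bool * bool} |
          [forall i in D, ~~ (H i \subset [set v | (chi v).1 == b])]]| <=
  4 * 4 ^ #|V|.
Proof.
move=> N0 D0 HN hs kr Nkr.
have k0 : 0 < k by case: (k) Nkr => //; lia.
set Bad := [set chi | _].
pose T0 (chi : {ffun V -> bool * bool}) :=
  fragment H D (color_class (b, false) chi).
pose G2 (chi : {ffun V -> bool * bool}) := [set i in D | #|T0 chi i| <= k].
pose T1 (chi : {ffun V -> bool * bool}) :=
  fragment (T0 chi) (G2 chi) (color_class (b, true) chi).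
pose E1 t := [set p : {ffun V -> bool * bool} * I |
   (p.2 \in D) && (#|T0 p.1 p.2| == t)].
pose E2 t := [set p : {ffun V -> bool * bool} * I |
   (p.2 \in G2 p.1) && (#|T1 p.1 p.2| == t)].
pose L := 4 ^ #|V| * (2 * #|D|).
have T0H chi i : i \in D -> T0 chi i \subset H i.
  by move=> iD; have [] := fragmentP H (color_class (b, false) chi) iD.
(* Here ['C(N, t) * (4 / r) ^ t <= (16 * N / (t * r)) ^ t], and [t > k] makes the base at most
   [1 / 16]. *)
have cnt1 t : 0 < t -> 16 ^ t * (if k < t then #|E1 t| else 0) <= L.
  move=> t0; case: ifP => kt; last by rewrite muln0.
  have := @fragment_count V I (b, false) (fun=> H) (fun=> D) H D N r
    (2 * #|D|) t (fun _ i iD => And3 iD (subxx _) (HN i iD))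
    (fun _ _ _ _ _ => conj erefl erefl) hs.
  rewrite -/(E1 t) => h.
  have N16 : 0 < (16 * N) ^ t by rewrite expn_gt0 muln_gt0 N0.
  rewrite -(leq_pmul2l N16) mulnA -expnMn.
  apply: leq_trans (_ : k ^ t * (r ^ t * #|E1 t|) <= _).
    by rewrite mulnA -expnMn leq_mul // leq_exp2r //; lia.
  apply: leq_trans (_ : t ^ t * (4 ^ #|V| * ('C(N, t) * (4 ^ t * (2 * #|D|)))) <= _).
    by rewrite leq_mul // leq_exp2r // ltnW.
  rewrite (_ : _ * _ = 'C(N, t) * t ^ t * (4 ^ t * L)); last by rewrite /L; lia.
  rewrite (_ : (16 * N) ^ t = (4 * N) ^ t * 4 ^ t); last first.
    by rewrite -expnMn; congr (_ ^ _); lia.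
  by rewrite -[X in _ <= X]mulnA leq_mul // bin_self_leq.
(* Now ['C(k, t) * (4 / r) ^ t <= (4 * k / r) ^ t], with base at most [1 / 16]. *)
have cnt2 t : 0 < t -> 16 ^ t * #|E2 t| <= L.
  move=> t0.
  have h : r ^ t * #|E2 t| <= 4 ^ #|V| * ('C(k, t) * (4 ^ t * (2 * #|D|))).
    apply: (@fragment_count V I (b, true) T0 G2 H D) hs.
      by move=> chi i; rewrite inE => /andP[iD ik]; split=> //; apply: T0H.
    move=> chi i T; rewrite inE => /andP[iD ik] TT0.
    have eW : color_class (b, false) (recolor (b, true) T chi) =
              color_class (b, false) chi.
      apply: color_class_recolor_neq; first by case: (b).
      exact: disjointWl TT0 (fragment_disjoint _ _ _ _).
    by rewrite /G2 /T0 eW.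
  have k4 : 0 < (4 * k) ^ t by rewrite expn_gt0 muln_gt0 k0.
  rewrite -(leq_pmul2l k4) mulnA -expnMn.
  apply: leq_trans (_ : r ^ t * #|E2 t| <= _).
    by rewrite leq_mul // leq_exp2r //; lia.
  apply: leq_trans h _.
  rewrite (_ : _ * _ = 'C(k, t) * (4 ^ t * L)); last by rewrite /L; lia.
  by rewrite expnMn [X in _ <= X * _]mulnC -[X in _ <= X]mulnA leq_mul // bin_leq_exp.
have sub : setX Bad D \subset
    (\bigcup_(t < N.+1 | 0 < t) (if k < t then E1 t else set0)) :|:
    \bigcup_(t < N.+1 | 0 < t) E2 t.
  apply/subsetP => -[chi i]; rewrite inE /= => /andP[].
  rewrite inE => /forall_inP bad iD.
  have T0N : #|T0 chi i| < N.+1.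
    exact: leq_trans (subset_leq_card (T0H chi i iD)) (HN i iD).
  rewrite inE; apply/orP; have [gt|le] := ltnP k #|T0 chi i|.
    left; apply/bigcupP; exists (Ordinal T0N); first exact: leq_trans gt.
    by rewrite /= gt inE /= iD eqxx.
  have iG : i \in G2 chi by rewrite inE iD.
  have [[j jG T1j] T1F _] :=
    fragmentP (T0 chi) (color_class (b, true) chi) iG.
  have T1N := leq_ltn_trans (subset_leq_card T1F) T0N.
  right; apply/bigcupP; exists (Ordinal T1N); last by rewrite inE /= iG eqxx.
  (* Were the second fragment empty, the second color would cover some [T0 chi j], which is an [H l]
     minus the first color; then [H l] would be covered. *)
  rewrite /= lt0n cards_eq0; apply/negP => /eqP T1_0.
  move: jG; rewrite inE => /andP[jD _].
  have [[l lD T0l] _ _] := fragmentP H (color_class (b, false) chi) jD.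
  have /negP[] := bad l lD; apply/subsetP => v vl; rewrite inE.
  have [vW|vW] := boolP (v \in color_class (b, false) chi).
    by move: vW; rewrite inE => /eqP ->.
  have vT : v \in T0 chi j by rewrite /T0 T0l inE vW.
  have [vW1|vW1] := boolP (v \in color_class (b, true) chi).
    by move: vW1; rewrite inE => /eqP ->.
  have : v \in T1 chi i by rewrite /T1 T1j inE vW1.
  by rewrite /T1 T1_0 inE.
have h : #|Bad| * #|D| <=
    \sum_(t < N.+1 | 0 < t) (if k < t then #|E1 t| else 0) +
    \sum_(t < N.+1 | 0 < t) #|E2 t|.
  rewrite -cardsX; apply: leq_trans (subset_leq_card sub) _.
  apply: leq_trans (leq_card_setU _ _) _.
  apply: leq_add; last exact: leq_card_bigcup.
  apply: leq_trans (leq_card_bigcup _ _) _; apply: leq_sum => t _.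
  by case: ifP; rewrite ?cards0.
have h1 := geometric_tail N.+1 cnt1; have h2 := geometric_tail N.+1 cnt2.
rewrite -(leq_pmul2r D0) -[X in X <= _]mulnA; move: h h1 h2; rewrite /L.
move: (#|Bad| * #|D|) (\sum_(_ | _) _) (\sum_(_ | _) _) => x y z; lia.
Qed.

(** * Families with factorial degrees and their spread links *)

Definition degree (V : finType) (A : {set {set V}}) (X : {set V}) : nat :=
  #|[set S in A | X \subset S]|.

(* Satisfied with [N = n] by the graphs of permutations of [n] points, and with
   [N = n.-1] by those mapping [i] to [j] once the point [(i, j)] is removed. *)
Definition factorial_degrees (V : finType) (N : nat) (A : {set {set V}}) : Prop :=
  (forall S, S \in A -> #|S| <= N) /\
  (forall X : {set V}, degree A X <= (N - #|X|)`!).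

Definition cross_meeting (V : finType) (A B : {set {set V}}) : Prop :=
  forall S T, S \in A -> T \in B -> ~~ [disjoint S & T].

Lemma cross_meetingC (V : finType) (A B : {set {set V}}) :
  cross_meeting A B -> cross_meeting B A.
Proof. by move=> h S T SB TA; rewrite disjoint_sym; apply: h. Qed.

Lemma degree0 (V : finType) (A : {set {set V}}) : degree A set0 = #|A|.
Proof. by apply: eq_card => S; rewrite !inE sub0set andbT. Qed.

Lemma sub_factorial_degrees (V : finType) N (A B : {set {set V}}) :
  B \subset A -> factorial_degrees N A -> factorial_degrees N B.
Proof.
move=> /subsetP BA [hs hd]; split=> [S /BA /hs //|X].
apply: leq_trans (hd X); apply: subset_leq_card; apply/subsetP => S.
by rewrite !inE => /andP[/BA -> ->].
Qed.

(* Take [X] maximizing [r ^ #|X| * degree A X]. *)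
Lemma spread_kernel (V : finType) N r m (A : {set {set V}}) :
  0 < r -> m <= N -> 4 * r <= N - m -> factorial_degrees N A ->
  r ^ m * (N - m)`! < #|A| ->
  exists X : {set V}, [/\ #|X| < m, 0 < degree A X &
    forall T : {set V}, [disjoint T & X] ->
      r ^ #|T| * degree A (X :|: T) <= degree A X].
Proof.
move=> r0 mN rN [hs hd] hA.
have [X _ Xmax] := @arg_maxnP _ set0 xpredT
  (fun X : {set V} => r ^ #|X| * degree A X) isT.
have AX : #|A| <= r ^ #|X| * degree A X.
  by have := Xmax set0 isT; rewrite cards0 mul1n degree0.
have dX : 0 < degree A X.
  by rewrite lt0n; apply/negP => /eqP d0; move: AX hA; rewrite d0 muln0; lia.
exists X; split=> //.
- rewrite ltnNge; apply/negP => mX.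
  have XN : #|X| <= N.
    move/card_gt0P: dX => [S]; rewrite inE => /andP[SA XS].
    exact: leq_trans (subset_leq_card XS) (hs S SA).
  (* If [m <= #|X|], then [r ^ #|X| * (N - #|X|)!] is at most [r ^ m * (N - m)!], against the size
     of [A]. *)
  have := @exp_fact_leq r (N - m) (#|X| - m) _ rN.
  rewrite leq_sub2r // => /(_ isT) h.
  move: hA; rewrite ltnNge => /negP[]; apply: leq_trans AX _.
  apply: leq_trans (_ : r ^ #|X| * (N - #|X|)`! <= _).
    by rewrite leq_mul2l hd orbT.
  rewrite -{1}(subnKC mX) expnD -mulnA leq_mul2l; apply/orP; right.
  by move: h; rewrite (_ : N - m - (#|X| - m) = N - #|X|) //; lia.
move=> T TX; have rX : 0 < r ^ #|X| by rewrite expn_gt0 r0.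
rewrite -(leq_pmul2l rX); apply: leq_trans (Xmax (X :|: T) isT).
rewrite mulnA -expnD cardsU setIC.
by move: TX; rewrite -setI_eq0 => /eqP ->; rewrite cards0 subn0.
Qed.


(* The link of [X] in [A] is spread; were many members of [B] disjoint from
   [X], a spread link of those would be found disjoint from the first one. *)
Lemma cross_avoid (V : finType) N r k (A B : {set {set V}}) :
  0 < N -> 64 * k <= r -> 256 * N <= k * r -> 4 * r <= N - 5 ->
  factorial_degrees N A -> factorial_degrees N B -> cross_meeting A B ->
  r ^ 5 * (N - 5)`! < #|A| ->
  exists X : {set V}, #|X| <= 4 /\
    #|[set S in B | [disjoint S & X]]| <= r ^ 3 * (N - 3)`!.
Proof.
move=> N0 kr Nkr rN fA fB AB hA.
have k0 : 0 < k by case: (k) Nkr => //; lia.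
have r0 : 0 < r by lia.
have N5 : 5 <= N by lia.
have [X [X4 dX spX]] := spread_kernel r0 N5 rN fA hA.
exists X; split=> //; rewrite leqNgt; apply/negP => hB.
set B' := [set S in B | _] in hB.
have fB' : factorial_degrees N B'.
  by apply: sub_factorial_degrees fB; apply/subsetP => S; rewrite inE => /andP[].
have N3 : 3 <= N by lia.
have rN3 : 4 * r <= N - 3 by lia.
have [Y [Y2 dY spY]] := spread_kernel r0 N3 rN3 fB' hB.
have YX : [disjoint Y & X].
  move/card_gt0P: dY => [S]; rewrite !inE => /andP[/andP[_ SX] YS].
  exact: disjointWl YS SX.
pose DA := [set S in A | (X \subset S) && [disjoint S & Y]].
pose DB := [set S in B' | Y \subset S].
(* At most two points [y] of [Y] have to be avoided, each lying in a fraction at most [1 / r] of the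
   link of [X]; so at least half of the link survives. *)
have dDA : degree A X <= 2 * #|DA|.
  have sub : [set S in A | X \subset S] \subset
      DA :|: \bigcup_(y in Y) [set S in A | X :|: [set y] \subset S].
    apply/subsetP => S; rewrite !inE => /andP[SA XS]; rewrite SA XS /=.
    have [//|] := boolP [disjoint S & Y].
    rewrite disjoint_sym => /pred0Pn[y /andP[/= yY yS]].
    apply/bigcupP; exists y => //; rewrite inE SA subUset XS sub1set; exact: yS.
  have h1 : degree A X <= #|DA| + \sum_(y in Y) degree A (X :|: [set y]).
    apply: leq_trans (subset_leq_card sub) _.
    apply: leq_trans (leq_card_setU _ _) _; rewrite leq_add2l.
    exact: leq_card_bigcup.
  have h2 : r * \sum_(y in Y) degree A (X :|: [set y]) <= 2 * degree A X.
    apply: leq_trans (_ : #|Y| * degree A X <= _); last by rewrite leq_mul2r; lia.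
    rewrite -sum_nat_const big_distrr /=; apply: leq_sum => y yY.
    have := spX [set y]; rewrite cards1 expn1; apply.
    by rewrite disjoints1 (disjointFr YX yY).
  by move: h1 h2; move: (\sum_(_ in _) _) => z; nia.
have DA0 : 0 < #|DA| by lia.
have DB0 : 0 < #|DB| by exact: dY.
have badA := @spread_covered V {set V} DA (fun S => S :\: X) N r k true N0 DA0.
have badB := @spread_covered V {set V} DB (fun S => S :\: Y) N r k false N0 DB0.
have {badA}/badA : forall S, S \in DA -> #|S :\: X| <= N.
  move=> S; rewrite inE => /andP[SA _].
  exact: leq_trans (subset_leq_card (subsetDl _ _)) (fA.1 S SA).
have {badB}/badB : forall S, S \in DB -> #|S :\: Y| <= N.
  move=> S; rewrite !inE => /andP[/andP[SB _] _].
  exact: leq_trans (subset_leq_card (subsetDl _ _)) (fB.1 S SB).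
have link (C : {set {set V}}) (E : {set {set V}}) (Z T : {set V}) :
    E \subset [set S in C | Z \subset S] ->
    (forall T : {set V}, [disjoint T & Z] ->
      r ^ #|T| * degree C (Z :|: T) <= degree C Z) ->
    r ^ #|T| * #|[set S in E | T \subset S :\: Z]| <= degree C Z.
  move=> /subsetP EC sp; have [TZ|TZ] := boolP [disjoint T & Z]; last first.
    rewrite (_ : [set S in E | _] = set0) ?cards0 ?muln0 //.
    apply/setP => S; rewrite !inE; apply/negbTE/negP => /andP[_ TS].
    move/negP: TZ; apply; apply: disjointWl TS _.
    by rewrite disjoints_subset subDset setUCr subsetT.
  apply: leq_trans (sp T TZ); rewrite leq_mul2l; apply/orP; right.
  apply: subset_leq_card; apply/subsetP => S; rewrite !inE => /andP[/EC].
  rewrite inE subUset => /andP[-> ->] /= TS.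
  exact: subset_trans TS (subsetDl _ _).
move=> badB badA.
have {}badA : 15 * _ <= _ := badA (fun T => leq_trans (link A DA X T _ spX) dDA) kr Nkr.
have {}badB : 15 * _ <= _ := badB (fun T => leq_trans (link B' DB Y T _ spY) (leq_pmull _ _)) kr Nkr.
have {badA}/badA badA : DA \subset [set S in A | X \subset S].
  by apply/subsetP => S; rewrite !inE => /and3P[-> ->].
have {badB}badB := badB (subxx _) isT.
set bA := [set chi | _] in badA; set bB := [set chi | _] in badB.
(* Each bad set contains at most [4 / 15] of the colorings, so some coloring is good for both
   families. *)
have : 0 < #|~: (bA :|: bB)|.
  have := cardsC (bA :|: bB); rewrite card_ffun card_prod card_bool.
  have := (leq_card_setU bA bB).1; rewrite -[2 * 2]/4.
  have : 0 < 4 ^ #|V| by rewrite expn_gt0.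
  move: badA badB; lia.
case/card_gt0P => chi; rewrite !inE negb_or !negb_forall.
case/andP => /existsP[S]; rewrite negb_imply negbK !inE => /andP[/and3P[SA XS SY] cS].
case/existsP => S'; rewrite negb_imply negbK !inE => /andP[/andP[/andP[SB' SX'] YS'] cS'].
move/negP: (AB _ _ SA SB'); apply; apply/pred0P => v /=.
apply/negbTE/negP => /andP[vS vS'].
have vX : v \notin X by rewrite (disjointFr SX' vS').
have vY : v \notin Y by rewrite (disjointFr SY vS).
have := subsetP cS v; rewrite !inE vX => /(_ vS) /eqP c1.
by have := subsetP cS' v; rewrite !inE vY c1 => /(_ vS').
Qed.

(** * Choice of the parameters *)

(** For [r] of order [sqrt N], [r ^ m * (N - m)!] has order [N! / N ^ (m / 2)]. The exponent 5 takes
    it below [N! / (q * N ^ 2)], the size forced on [A] by the product bound and [#|B| <= N!]; the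
    exponent 3 takes it below [(N.-1)! / (10 * q)]. *)
Definition admissible (q N r k : nat) : Prop :=
  [/\ 64 * k <= r, 256 * N <= k * r, 4 * r < N - 5,
      q * r ^ 5 * (N - 5)`! * N < (N.-1)`! &
      10 * q * (r ^ 3 * (N - 3)`!) <= (N.-1)`!].

Lemma exists_sqrt N : exists s, s ^ 2 <= N < s.+1 ^ 2.
Proof.
elim: N => [|N [s /andP[h1 h2]]]; first by exists 0.
have [lt|ge] := ltnP N.+1 (s.+1 ^ 2).
  by exists s; rewrite lt andbT (leq_trans h1).
by exists s.+1; rewrite ge /=; move: h2 ge; nia.
Qed.

(* With [u] about the square root of [N], take [k = 2 * u] and [r = 128 * u]. *)
Lemma admissible_large : exists C, forall q N, 0 < q -> C * q ^ 2 <= N ->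
  exists r k, admissible q N r k.
Proof.
(* The three lower bounds on [c] serve, in order, the condition with [r ^ 5], the one with [r ^ 3],
   and the size of [u]. *)
have [c [c_def cb1 cb2]] :
    exists c, [/\ 256 * 128 ^ 5 <= c, 160 * 128 ^ 3 <= c & 64 * 64 <= c].
  move: (256 * _) (160 * _) (64 * _) => x y z; exists (x + y + z).
  by split; lia.
exists (c ^ 2) => q N q0; rewrite -expnMn => qN.
have [s /andP[sN Ns]] := exists_sqrt N.
set u := s.+1 in Ns.
have cu : c * q < u by rewrite -(ltn_exp2r _ _ (isT : 0 < 2)); apply: leq_ltn_trans qN Ns.
have cqc : c <= c * q by rewrite leq_pmulr.
have u5 : 64 * 64 < u by lia.
have N4 : u ^ 2 <= 4 * (N - 4).
  move: sN; rewrite (_ : s = u - 1); last by rewrite /u subn1.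
  nia.
have N7 : 8 <= N by nia.
have factB m : m < N -> (N - m)`! = (N - m) * (N - m.+1)`!.
  by move=> mN; rewrite (_ : N - m = (N - m.+1).+1) ?factS //; lia.
have eN : (N.-1)`! = (N - 1) * ((N - 2) * (N - 3)`!).
  by rewrite -subn1 factB ?[X in _ * X]factB //; lia.
have eN3 : (N - 3)`! = (N - 3) * ((N - 4) * (N - 5)`!).
  by rewrite factB ?[X in _ * X]factB //; lia.
exists (128 * u), (2 * u); split.
- lia.
- move: Ns; rewrite -mulnn; nia.
- move: N4; rewrite -mulnn; nia.
- rewrite eN eN3; have f0 := fact_gt0 (N - 5).
  (* Once [(N - 5)!] is cancelled, the left side has order [q * u ^ 7] and the right side is at
     least [u ^ 8 / 256]; [c * q < u] closes the gap. *)
  have h8 : u ^ 8 <= 256 * (N - 4) ^ 4.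
    by rewrite -[8]/(2 * 4) expnM -[256]/(4 ^ 4) -expnMn leq_exp2r.
  have h4 : (N - 4) ^ 4 <= (N - 1) * ((N - 2) * ((N - 3) * (N - 4))).
    by rewrite !expnS expn0 muln1 !leq_mul //; lia.
  have h7 : 256 * (q * (128 * u) ^ 5 * N) < u ^ 8.
    rewrite (_ : u ^ 8 = u * u ^ 5 * u ^ 2); last by rewrite -expnS -expnD.
    have le : 256 * (q * (128 * u) ^ 5 * N) <= c * q * u ^ 5 * N.
      rewrite expnMn.
      rewrite (_ : 256 * _ = 256 * 128 ^ 5 * (q * u ^ 5 * N)); last lia.
      by rewrite -[c * q * _]mulnA -[c * _ * N]mulnA leq_mul2r c_def orbT.
    apply: leq_ltn_trans le _.
    apply: leq_ltn_trans (_ : c * q * u ^ 5 * u ^ 2 < _).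
      by rewrite leq_mul2l (ltnW Ns) orbT.
    by rewrite ltn_mul2r expn_gt0 /= ltn_mul2r expn_gt0 cu andbT; lia.
  have h : q * (128 * u) ^ 5 * N < (N - 1) * ((N - 2) * ((N - 3) * (N - 4))).
    apply: leq_trans h4; lia.
  rewrite (_ : (N - 1) * _ = (N - 1) * ((N - 2) * ((N - 3) * (N - 4))) * (N - 5)`!);
    last lia.
  by rewrite mulnAC ltn_mul2r f0 h.
- rewrite eN.
  have h4 : u ^ 4 <= 16 * ((N - 1) * (N - 2)).
    apply: leq_trans (_ : 16 * (N - 4) ^ 2 <= _).
      by rewrite -[X in u ^ X]/(2 * 2) expnM -[16]/(4 ^ 2) -expnMn leq_exp2r.
    by rewrite leq_mul2l -mulnn leq_mul //; lia.
  have h : 160 * 128 ^ 3 * q * u ^ 3 <= u ^ 4.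
    rewrite expnS leq_mul2r; apply/orP; right.
    by apply: leq_trans (ltnW cu); rewrite leq_mul2r cb1 orbT.
  rewrite expnMn; have f0 := fact_gt0 (N - 3).
  rewrite (_ : 10 * q * _ = 10 * q * (128 ^ 3 * u ^ 3) * (N - 3)`!); last lia.
  by rewrite [X in _ <= X]mulnA leq_pmul2r //; lia.
Qed.

Lemma card_leq_fact (V : finType) N (A : {set {set V}}) :
  factorial_degrees N A -> #|A| <= N`!.
Proof. by case=> _ /(_ set0); rewrite degree0 cards0 subn0. Qed.

Lemma card_leq_degrees (V : finType) (B : {set {set V}}) (X : {set V}) :
  #|B| <= #|[set S in B | [disjoint S & X]]| + \sum_(x in X) degree B [set x].
Proof.
have sub : B \subset [set S in B | [disjoint S & X]] :|:
    \bigcup_(x in X) [set S in B | [set x] \subset S].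
  apply/subsetP => S SB; rewrite !inE SB /=.
  have [//|] := boolP [disjoint S & X].
  rewrite disjoint_sym => /pred0Pn[x /andP[/= xX xS]].
  by apply/bigcupP; exists x => //; rewrite inE SB sub1set.
apply: leq_trans (subset_leq_card sub) _.
by apply: leq_trans (leq_card_setU _ _) _; rewrite leq_add2l leq_card_bigcup.
Qed.

(** * Size bounds and a popular point for cross-meeting families *)

Section CrossMeeting.

Variables (V : finType) (q N r k : nat).
Hypotheses (q_gt0 : 0 < q) (adm : admissible q N r k).

Lemma admissible_gt0 : 0 < N.
Proof. by case: adm => _ _ rN _ _; lia. Qed.

Lemma cross_cover (A B : {set {set V}}) :
  factorial_degrees N A -> factorial_degrees N B -> cross_meeting A B ->
  (N.-1)`! ^ 2 <= q * (#|A| * #|B|) ->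
  exists X : {set V}, #|X| <= 4 /\
    10 * q * #|[set S in B | [disjoint S & X]]| <= (N.-1)`!.
Proof.
move=> fA fB AB h; have N0 := admissible_gt0; case: adm => kr Nkr /ltnW rN aA aB.
have hA : r ^ 5 * (N - 5)`! < #|A|.
  rewrite ltnNge; apply/negP => leA.
  have eN : N`! = N * (N.-1)`! by rewrite -{1}(prednK N0) factS prednK.
  have := card_leq_fact fB; rewrite eN => leB.
  have := leq_mul leA leB => leAB.
  have := leq_trans h (leq_mul (leqnn q) leAB).
  have f0 := fact_gt0 N.-1.
  rewrite -mulnn !mulnA leq_pmul2r //; move: aA; rewrite !mulnA; lia.
have [X [X4 hX]] := cross_avoid N0 kr Nkr rN fA fB AB hA.
exists X; split=> //; apply: leq_trans aB.
by rewrite leq_mul2l hX orbT.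
Qed.

(** The at most four points of the cover have degree at most [(N.-1)!] each, and the members
    avoiding them number at most [(N.-1)!] more. *)
Lemma cross_card_r (A B : {set {set V}}) :
  factorial_degrees N A -> factorial_degrees N B -> cross_meeting A B ->
  (N.-1)`! ^ 2 <= q * (#|A| * #|B|) -> #|B| <= 5 * (N.-1)`!.
Proof.
move=> fA fB AB h; have [X [X4 hX]] := cross_cover fA fB AB h.
have le : \sum_(x in X) degree B [set x] <= 4 * (N.-1)`!.
  apply: leq_trans (_ : #|X| * (N.-1)`! <= _); last by rewrite leq_mul2r X4 orbT.
  rewrite -sum_nat_const; apply: leq_sum => x _.
  by have := fB.2 [set x]; rewrite cards1 subn1.
have := card_leq_degrees B X; move: hX le q_gt0.
move: (\sum_(_ in _) _) #|[set S in B | _]| => x y.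
nia.
Qed.

(** The upper bound 5 on one family turns the product bound into a lower bound [1 / (5 * q)] on the
    other, in units of [(N.-1)!]. At most [1 / (10 * q)] of [B] avoids the cover, so one of its at
    most four points carries a quarter of the remaining [1 / (10 * q)]. *)
Lemma cross_popular (A B : {set {set V}}) :
  factorial_degrees N A -> factorial_degrees N B -> cross_meeting A B ->
  (N.-1)`! ^ 2 <= q * (#|A| * #|B|) ->
  (N.-1)`! <= 5 * q * #|A| /\
  exists x, (N.-1)`! <= 40 * q * degree B [set x].
Proof.
move=> fA fB AB h.
have h' : (N.-1)`! ^ 2 <= q * (#|B| * #|A|) by rewrite [#|B| * _]mulnC.
have B5 := cross_card_r fA fB AB h.
have A5 := cross_card_r fB fA (cross_meetingC AB) h'.
have f0 := fact_gt0 N.-1.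
have lowA : (N.-1)`! <= 5 * q * #|A|.
  rewrite -(leq_pmul2r f0) mulnn; apply: leq_trans h _.
  apply: leq_trans (_ : q * (#|A| * (5 * (N.-1)`!)) <= _); last lia.
  by rewrite !leq_mul.
have lowB : (N.-1)`! <= 5 * q * #|B|.
  rewrite -(leq_pmul2r f0) mulnn; apply: leq_trans h _.
  apply: leq_trans (_ : q * (5 * (N.-1)`! * #|B|) <= _); last lia.
  by rewrite !leq_mul.
split=> //; have [X [X4 hX]] := cross_cover fA fB AB h.
have [x|none] := pickP (fun x => (N.-1)`! <= 40 * q * degree B [set x]).
  by exists x.
exfalso.
(* The constants fit exactly, so strictness has to survive the summation: hence the predecessor of
   the factorial. *)
have le : 40 * q * \sum_(x in X) degree B [set x] <= #|X| * ((N.-1)`!).-1.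
  rewrite -sum_nat_const big_distrr /=; apply: leq_sum => x _.
  by have := none x; lia.
have := card_leq_degrees B X.
have : #|X| * ((N.-1)`!).-1 <= 4 * ((N.-1)`!).-1 by rewrite leq_mul2r X4 orbT.
move: hX le lowB; move: (\sum_(_ in _) _) #|[set S in B | _]| => x y.
nia.
Qed.

End CrossMeeting.

(** Once the product exceeds [(N.-1)! ^ 2], [cross_card_r] applies to both families with [q = 1]. *)
Lemma cross_card_mul (V : finType) N r k (A B : {set {set V}}) :
  admissible 1 N r k ->
  factorial_degrees N A -> factorial_degrees N B -> cross_meeting A B ->
  #|A| * #|B| <= 25 * (N.-1)`! ^ 2.
Proof.
move=> adm fA fB AB; have [le|/ltnW gt] := leqP (#|A| * #|B|) ((N.-1)`! ^ 2).
  by apply: leq_trans le _; rewrite leq_pmull.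
have gt' : (N.-1)`! ^ 2 <= 1 * (#|A| * #|B|) by rewrite mul1n.
have gt'' : (N.-1)`! ^ 2 <= 1 * (#|B| * #|A|) by rewrite [#|B| * _]mulnC.
have B5 := @cross_card_r V 1 N r k isT adm _ _ fA fB AB gt'.
have A5 := @cross_card_r V 1 N r k isT adm _ _ fB fA (cross_meetingC AB) gt''.
by have := leq_mul A5 B5; rewrite -mulnn; lia.
Qed.

(** * Permutations as sets of grid points *)

Section Permutations.

Variable n : nat.
Implicit Types (s t : {perm 'I_n}) (A B : {set {perm 'I_n}}).

Definition graph s : {set 'I_n * 'I_n} := [set p | p.2 == s p.1].

Definition maps_to A (i j : 'I_n) : {set {perm 'I_n}} := [set s in A | s i == j].

Lemma mem_graph s i j : ((i, j) \in graph s) = (s i == j).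
Proof. by rewrite inE eq_sym. Qed.

Lemma graph_inj : injective graph.
Proof.
move=> s t eq_st; apply/permP => i; apply/esym/eqP.
by rewrite -mem_graph -eq_st mem_graph.
Qed.

Lemma card_graph s : #|graph s| = n.
Proof.
rewrite -[RHS](card_ord n) -(card_imset _ (_ : injective (fun i => (i, s i)))).
  apply: eq_card => -[i j]; rewrite mem_graph; apply/eqP/imsetP => [<-|[l _ [-> ->]] //].
  by exists i.
by move=> i j [].
Qed.

(** Composing with the inverse of one extension [s0] sends all extensions to permutations fixing the
    first coordinates of [X], which are distinct. *)
Lemma card_perm_extending (X : {set 'I_n * 'I_n}) :
  #|[set s | X \subset graph s]| <= (n - #|X|)`!.
Proof.
have [s0 Xs0|none] := pickP (fun s => X \subset graph s); last first.
  rewrite (_ : [set s | _] = set0) ?cards0 //.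
  by apply/setP => s; rewrite !inE none.
pose D := fst @: X.
have cD : #|D| = #|X|.
  apply: card_in_imset => -[i j] [i' j'] /(subsetP Xs0) + /(subsetP Xs0).
  by rewrite !mem_graph => /eqP <- /eqP <- /= ->.
rewrite (_ : n - #|X| = #|~: D|); last first.
  by have := cardsC D; rewrite card_ord cD; lia.
rewrite -card_perm.
rewrite -(card_imset _ (mulIg (s0^-1)%g)); apply: subset_leq_card.
apply/subsetP => _ /imsetP[s + ->]; rewrite inE => Xs.
apply/subsetP => i; rewrite inE => nfix; rewrite inE; apply/negP => /imsetP[[l j] lX il].
move/negP: nfix; apply; rewrite /= in il; subst l.
move: (subsetP Xs _ lX) (subsetP Xs0 _ lX); rewrite !mem_graph permM.
by move=> /eqP -> /eqP <-; rewrite permK.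
Qed.

Lemma graph_factorial_degrees A : factorial_degrees n (graph @: A).
Proof.
split=> [_ /imsetP[s _ ->]|X]; first by rewrite card_graph.
apply: leq_trans (card_perm_extending X).
apply: leq_trans (leq_imset_card graph _); apply: subset_leq_card.
apply/subsetP => S; rewrite inE => /andP[/imsetP[s _ ->] Xs].
by apply: imset_f; rewrite inE.
Qed.

Lemma degree_graph A i j : degree (graph @: A) [set (i, j)] = #|maps_to A i j|.
Proof.
rewrite -(card_imset _ graph_inj); apply: eq_card => S; rewrite inE.
apply/andP/imsetP => [[/imsetP[s sA ->]]|[s]].
  by rewrite sub1set mem_graph => sij; exists s => //; rewrite inE sA.
by rewrite inE => /andP[sA sij] ->; rewrite sub1set mem_graph imset_f.
Qed.

Lemma graph_cross_meeting A B :
  cross_intersecting A B -> cross_meeting (graph @: A) (graph @: B).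
Proof.
move=> AB _ _ /imsetP[s sA ->] /imsetP[t tB ->].
have [i st] := AB s t sA tB; apply/pred0Pn; exists (i, s i) => /=.
by rewrite !mem_graph st eqxx.
Qed.

Definition punctured_graphs A (i j : 'I_n) : {set {set 'I_n * 'I_n}} :=
  [set graph s :\ (i, j) | s in maps_to A i j].

Lemma card_punctured_graphs A i j : #|punctured_graphs A i j| = #|maps_to A i j|.
Proof.
apply: card_in_imset => s t; rewrite !inE -!mem_graph => /andP[_ si] /andP[_ ti] st.
by apply: graph_inj; rewrite -(setD1K si) st setD1K.
Qed.

Lemma punctured_factorial_degrees A i j :
  factorial_degrees n.-1 (punctured_graphs A i j).
Proof.
split=> [_ /imsetP[s + ->]|X].
  rewrite inE -mem_graph => /andP[_ si].
  by have := card_graph s; rewrite (cardsD1 (i, j) (graph s)) si add1n; move: #|_ :\ _| => m; lia.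
(* A set containing the removed point has degree 0; any other regains it, and the extra point
   accounts for [n.-1]. *)
have [iX|iX] := boolP ((i, j) \in X).
  rewrite /degree (_ : [set S in _ | _] = set0) ?cards0 //.
  apply/setP => S; rewrite inE [RHS]inE; apply/negbTE/negP.
  case/andP => /imsetP[s _ ->] /subsetP /(_ _ iX); by rewrite !inE eqxx.
have := card_perm_extending ((i, j) |: X).
rewrite cardsU1 iX add1n (_ : n - #|X|.+1 = n.-1 - #|X|); last lia.
apply: leq_trans; apply: leq_trans (leq_imset_card (fun s => graph s :\ (i, j)) _).
apply: subset_leq_card; apply/subsetP => S.
rewrite inE => /andP[/imsetP[s + ->] Xs]; rewrite inE -mem_graph => /andP[_ si].
apply: imset_f; rewrite inE subUset sub1set si.
exact: subset_trans Xs (subsetDl _ _).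
Qed.

Lemma punctured_cross_meeting A B i j j' : j' != j -> cross_intersecting A B ->
  cross_meeting (punctured_graphs A i j') (punctured_graphs B i j).
Proof.
move=> jj AB _ _ /imsetP[s + ->] /imsetP[t + ->].
rewrite !inE => /andP[sA /eqP si] /andP[tB /eqP ti].
have [l st] := AB s t sA tB.
have li : l != i by apply: contraNneq jj => li; rewrite -si -ti -li st.
apply/pred0Pn; exists (l, s l) => /=.
by rewrite !inE /= st eqxx !xpair_eqE (negPf li).
Qed.

(* Different values at [i] force the two slices to meet elsewhere, so their
   product is at most [25 * (n.-2)`! ^ 2]. *)
Lemma slice_bootstrap q r k A B i j : 1 < n -> admissible 1 n.-1 r k ->
  cross_intersecting A B -> (n.-1)`! <= 40 * q * #|maps_to B i j| ->
  #|[set s in A | s i != j]| <= 40 * 25 * q * (n.-2)`!.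
Proof.
move=> n1 adm AB hB.
have eN : (n.-1)`! = n.-1 * (n.-2)`!.
  by rewrite (_ : n.-1 = (n.-2).+1) ?factS //; lia.
(* The slice of [B] has at least [(n.-1)! / (40 * q)] members; dividing the product bound by this
   gains a factor [n.-1], which pays for the [n.-1] values [j']. *)
have slice j' : j' != j -> n.-1 * #|maps_to A i j'| <= 40 * 25 * q * (n.-2)`!.
  move=> jj; have := cross_card_mul adm (punctured_factorial_degrees A i j')
    (punctured_factorial_degrees B i j) (punctured_cross_meeting jj AB).
  rewrite !card_punctured_graphs => h; have f0 := fact_gt0 n.-2.
  rewrite -(leq_pmul2r f0).
  apply: leq_trans (_ : (n.-1)`! * #|maps_to A i j'| <= _); first by rewrite eN; lia.
  apply: leq_trans (_ : 40 * q * (#|maps_to A i j'| * #|maps_to B i j|) <= _).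
    by rewrite [#|maps_to A i j'| * _]mulnC mulnA leq_mul2r hB orbT.
  apply: leq_trans (leq_mul (leqnn (40 * q)) h) _; rewrite -mulnn; lia.
have n0 : 0 < n.-1 by lia.
rewrite -(leq_pmul2l n0).
apply: leq_trans (_ : n.-1 * \sum_(j' | j' != j) #|maps_to A i j'| <= _).
  rewrite leq_mul2l; apply/orP; right; apply: leq_trans (leq_card_bigcup _ _).
  apply: subset_leq_card; apply/subsetP => s; rewrite inE => /andP[sA sij].
  by apply/bigcupP; exists (s i) => //; rewrite inE sA eqxx.
rewrite big_distrr /=; apply: (@leq_trans (\sum_(j' | j' != j) 40 * 25 * q * (n.-2)`!)).
  exact: leq_sum.
by rewrite sum_nat_const cardC1 card_ord.
Qed.

End Permutations.

(** * Stability, first over the integers, then over the reals *)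

(** The integer [q] stands for an upper bound on [c ^- 2], and the error is explicit in [q] so that
    [C] can be fixed before [q]. *)
Lemma cross_intersecting_stability : exists C, forall n q (A B : {set {perm 'I_n}}),
  0 < q -> 0 < #|A| * #|B| -> cross_intersecting A B ->
  (n.-1)`! ^ 2 <= q * (#|A| * #|B|) ->
  exists i j : 'I_n,
    #|[set s in A | s i != j]| <= C * q ^ 4 * (n.-2)`! /\
    #|[set s in B | s i != j]| <= C * q ^ 4 * (n.-2)`!.
Proof.
have [C0 hC0] := admissible_large.
pose M := C0 + 100 * 100 + 3; exists (M ^ 2 + 40 * 25) => n q A B q0 AB0 AB h.
(* For small [n] any point will do, since [n! <= n ^ 2 * (n.-2)!] and [n ^ 2 <= M ^ 2 * q ^ 4]; this
   is the source of the fourth power. *)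
have [small|large] := ltnP n (M * q ^ 2).
  have [s [t [sA tB]]] : exists s t, s \in A /\ t \in B.
    move: AB0; rewrite muln_gt0 => /andP[/card_gt0P[s sA] /card_gt0P[t tB]].
    by exists s, t.
  have [i _] := AB s t sA tB.
  have le (D : {set {perm 'I_n}}) :
      #|[set s in D | s i != i]| <= (M ^ 2 + 40 * 25) * q ^ 4 * (n.-2)`!.
    apply: leq_trans (_ : n ^ 2 * (n.-2)`! <= _).
      apply: leq_trans (max_card _) _; rewrite card_Sn.
      case: (n) i => [[]|[//|m]] _ //=.
      by rewrite !factS mulnA leq_mul2r -mulnn leq_mul // orbT.
    rewrite leq_mul2r; apply/orP; right.
    apply: leq_trans (_ : (M * q ^ 2) ^ 2 <= _); first by rewrite leq_exp2r // ltnW.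
    by rewrite expnMn -expnM leq_mul2r leq_addr orbT.
  by exists i, i.
have q2 : 0 < q ^ 2 by rewrite expn_gt0 q0.
have nC0 : C0 * q ^ 2 <= n.-1 by move: large; rewrite /M; nia.
have n100 : 100 * 100 * q ^ 2 < n.-1 by move: large; rewrite /M; nia.
have [r [k adm]] := hC0 q n q0 (leq_trans nC0 (leq_pred n)).
have [r1 [k1 adm1]] : exists r k, admissible 1 n.-1 r k.
  by apply: hC0 => //; apply: leq_trans nC0; rewrite leq_mul2l exp1n q2 orbT.
have n1 : 1 < n by lia.
have [lowA [[i j] popB]] := cross_popular q0 adm (graph_factorial_degrees A)
  (graph_factorial_degrees B) (graph_cross_meeting AB)
  (eq_ind_r (fun x => _ <= q * (x * _)) (eq_ind_r (fun x => _ <= q * (_ * x)) h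
     (card_imset _ (@graph_inj n))) (card_imset _ (@graph_inj n))).
rewrite degree_graph in popB; rewrite card_imset in lowA; last exact: graph_inj.
have boundA := slice_bootstrap n1 adm1 AB popB.
have BA : cross_intersecting B A.
  by move=> s t sB tA; have [l] := AB t s tA sB; exists l.
(* [A] has at least [(n.-1)! / (5 * q)] members, and for large [n] at most [(n.-1)! / (10 * q)] of
   them miss [(i, j)]. *)
have popA : (n.-1)`! <= 40 * q * #|maps_to A i j|.
  have split : #|A| <= #|maps_to A i j| + #|[set s in A | s i != j]|.
    apply: leq_trans (leq_card_setU _ _); apply: subset_leq_card.
    by apply/subsetP => s sA; rewrite !inE sA /=; case: eqP.
  have eN : (n.-1)`! = n.-1 * (n.-2)`!.
    by rewrite (_ : n.-1 = (n.-2).+1) ?factS //; lia.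
  have big : 10 * q * (40 * 25 * q * (n.-2)`!) <= (n.-1)`!.
    rewrite eN (_ : _ * _ = 100 * 100 * q ^ 2 * (n.-2)`!); last by rewrite -mulnn; lia.
    by rewrite leq_mul2r (ltnW n100) orbT.
  have qx := leq_trans (leq_mul (leqnn (10 * q)) boundA) big.
  move: (leq_mul (leqnn q) split) lowA qx; rewrite mulnDr -!mulnA.
  move: (q * _) (q * _) (q * _) (n.-1)`! => x y z f; clear; lia.
have boundB := slice_bootstrap n1 adm1 BA popA.
have le : 40 * 25 * q * (n.-2)`! <= (M ^ 2 + 40 * 25) * q ^ 4 * (n.-2)`!.
  rewrite leq_mul2r; apply/orP; right; apply: leq_mul; first exact: leq_addl.
  by rewrite -{1}[q]expn1 leq_pexp2l.
by exists i, j; split; apply: leq_trans le.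
Qed.

Local Open Scope ring_scope.

(* [R] need not be archimedean, so [q] below is chosen from [n], [A] and [B], and
   only the bound [q <= 1 + c ^- 2] is uniform. *)
Theorem theorem8 (R : rcfType) (c : R) (hc : 0 < c) :
  exists K : R, 0 < K /\
  forall (n : nat) (A B : {set {perm 'I_n}}),
    cross_intersecting A B ->
    Num.sqrt ((#|A| * #|B|)%:R) >= c * ((n.-1)`!)%:R ->
    exists i j : 'I_n,
      (#|[set s in A | s i != j]|)%:R <= K * ((n.-2)`!)%:R /\
      (#|[set s in B | s i != j]|)%:R <= K * ((n.-2)`!)%:R.
Proof.
have [C hC] := cross_intersecting_stability.
have c2 : 0 < c ^+ 2 by rewrite exprn_gt0.
have K0 : 0 <= 1 + c ^- 2 by rewrite addr_ge0 // invr_ge0 ltW.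
(* The successor of [C] ensures positivity, as [C] may be 0. *)
exists (C.+1%:R * (1 + c ^- 2) ^+ 4); split.
  by rewrite mulr_gt0 ?ltr0n // exprn_gt0 // ltr_pwDl // invr_ge0 ltW.
move=> n A B AB; set d := (#|A| * #|B|)%N => hsqrt.
have hd : c ^+ 2 * ((n.-1)`! ^ 2)%:R <= d%:R.
  rewrite natrX -exprMn -[d%:R]sqr_sqrtr ?ler0n // lerXn2r //.
  - by rewrite nnegrE mulr_ge0 ?ler0n ?ltW.
  - by rewrite nnegrE sqrtr_ge0.
have d0 : (0 < d)%N.
  rewrite -(ltr0n R); apply: lt_le_trans hd.
  by rewrite mulr_gt0 // ltr0n expn_gt0 fact_gt0.
(* The floor plus one gives [(n.-1)! ^ 2 < q * d], and [hd] bounds the quotient by [c ^- 2]. *)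
pose q := ((n.-1)`! ^ 2 %/ d).+1.
have qK : q%:R <= 1 + c ^- 2.
  rewrite -natr1 addrC lerD2l -[c ^- 2]mul1r ler_pdivlMr // mulrC.
  have dR : 0 < d%:R :> R by rewrite ltr0n.
  rewrite -(ler_pM2r dR) mul1r -mulrA -natrM; apply: le_trans hd.
  by rewrite ler_pM2l // ler_nat leq_trunc_div.
have hq : ((n.-1)`! ^ 2 <= q * d)%N by rewrite ltnW // ltn_ceil.
have [i [j [bA bB]]] := hC n q A B isT d0 AB hq.
have bound m : (m <= C * q ^ 4 * (n.-2)`!)%N ->
    m%:R <= C.+1%:R * (1 + c ^- 2) ^+ 4 * ((n.-2)`!)%:R.
  rewrite -(ler_nat R) => /le_trans; apply.
  rewrite natrM ler_wpM2r ?ler0n // natrM natrX.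
  apply: ler_pM; rewrite ?ler0n ?exprn_ge0 ?ler_nat //.
  by rewrite lerXn2r // nnegrE ler0n.
by exists i, j; split; apply: bound.
Qed.
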